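(* Let $\{S(t): t\ge 0\}$ be a semigroup on a nonempty subset $V$ of a normed space $(X,\|\cdot\|_X)$, $T>0$ and let $B$ be a bounded subset of $V$. If the semigroup satisfies the smoothing property on $B$ at time $T$ with parameters $(\eta,\kappa)$, then it satisfies the generalized smoothing property on $B$ at time $T$ and hence, it is quasi-stable on $B$ at time $T$ with parameters $(\eta,\kappa)$. Moreover, if $S(T)B\subseteq B$, then for any $\sigma\in(0,1-\eta)$ there exist $k_0\in\mathbb{N}$ and $a,b>0$ such that the covering condition $$N^{V}(S(kT)B,aq^{k})\le b h^{k},\quad k\in\mathbb{N},\ k\ge k_0,$$ holds with $q=\eta+\sigma$ and $$h=\begin{cases}m_{\|\cdot\|_X}\left(\overline{B}^Z(0,1),\frac{\sigma}{2\kappa}\right)&\text{if alternative (i) of the smoothing property holds},\\ m_{\|\cdot\|_Y}\left(\overline{B}^X(0,1),\frac{\sigma}{2\kappa}\right)&\text{if alternative (ii) of the smoothing property holds}.\end{cases}$$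
   Context: $\mathbb{N}=\{1,2,\dots\}$. $V$ carries the metric $d(x,y)=\|x-y\|_X$. A semigroup $\{S(t):t\ge0\}$ on $V$ is a family of (not necessarily linear) maps $S(t):V\to V$ with $S(t)S(s)=S(t+s)$ for $t,s\ge 0$ and $S(0)=I$; ''$t\ge 0$'' means throughout either $t\in[0,\infty)$ or $t\in\mathbb{N}\cup\{0\}$ (and $T$ belongs to the time set). Smoothing property on $B\subseteq V$ at time $T>0$ with parameters $(\eta,\kappa)$: $S(T)=C(T)+M(T)$ on $B$, where $\eta\in[0,1)$, $\kappa>0$, $$\|C(T)x-C(T)y\|_X\le\eta\|x-y\|_X,\quad x,y\in B,$$ and one of the following holds: (i) $M(T):B\to Z$, where $Z$ is an auxiliary normed space compactly embedded into $X$, and $\|M(T)x-M(T)y\|_Z\le\kappa\|x-y\|_X$ for $x,y\in B$; (ii) $X$ is compactly embedded into a normed space $Y$ and $\|M(T)x-M(T)y\|_X\le\kappa\|x-y\|_Y$ for $x,y\in B$. Generalized smoothing property on $B$ at time $T$: there exist normed spaces $Y',Z'$ with $Z'$ compactly embedded into $Y'$, a map $M:B\to Z'$ and parameters $\eta'\in[0,1)$, $\mu'>0$, $\kappa'>0$ such that for all $x,y\in B$: $\|Mx-My\|_{Z'}\le\kappa' d(x,y)$ and $d(S(T)x,S(T)y)\le\eta' d(x,y)+\mu'\|Mx-My\|_{Y'}$. A compact seminorm on a normed space $W$ is a seminorm $\mathfrak{n}_W$ such that any bounded sequence $w_k\in W$ has a subsequence $w_{k_j}$ with $\mathfrak{n}_W(w_{k_j}-w_{k_l})\to0$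 as $j,l\to\infty$. The semigroup is quasi-stable on $B$ at time $T$ with parameters $(\eta,\kappa)$ if there are a normed space $W$, a compact seminorm $\mathfrak{n}_W$ on $W$ and a map $K:B\to W$ such that for all $x,y\in B$: $\|Kx-Ky\|_W\le\kappa d(x,y)$ and $d(S(T)x,S(T)y)\le\eta d(x,y)+\mathfrak{n}_W(Kx-Ky)$ (with $\eta\in[0,1)$, $\kappa>0$). $\overline{B}^Z(0,1)$ is the closed unit ball of $Z$; $m_{\|\cdot\|_Y}(F,\varepsilon)$ is the maximal cardinality of a subset $U\subseteq F$ with $\|x-y\|_Y\ge\varepsilon$ for all $x,y\in U$, $x\neq y$. $N^V(G,\varepsilon)$ is the minimal number of open $\varepsilon$-balls in $V$ centered at points of $G$ needed to cover $G$. *)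

(* Defs.v *)
From HB Require Import structures.
From mathcomp Require Import all_boot all_order all_algebra.
From mathcomp Require Import all_classical all_reals all_analysis.

Set Implicit Arguments.
Unset Strict Implicit.
Unset Printing Implicit Defensive.

Import Order.TTheory GRing.Theory Num.Theory.
Import numFieldNormedType.Exports.

Local Open Scope classical_set_scope.
Local Open Scope ring_scope.

(* Maps defined on a subset of a normed space (S t on V; C, M and K on B) are
   represented by total functions of which only the values on that subset
   matter. *)

Inductive time_kind := continuous_time | discrete_time.

Definition time_set (R : realType) (tk : time_kind) : set R :=
  match tk with
  | continuous_time => [set t | 0 <= t]
  | discrete_time => [set n%:R | n in [set: nat]]
  end.

Record semigroup_on (R : realType) (tk : time_kind) (X : normedModType R)
    (V : set X) (S : R -> X -> X) : Prop := SemigroupOn {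
  semigroup_stable : forall t, time_set tk t -> set_fun V V (S t);
  semigroup_comp : forall t s x, time_set tk t -> time_set tk s -> V x ->
    S t (S s x) = S (t + s) x;
  semigroup_id : forall x, V x -> S 0 x = x
}.

(* "Z is compactly embedded into X", for the inclusion map i : Z -> X;
   [precompact A] is compactness of the closure of A, so continuity of i
   follows. *)
Definition compact_embedding (R : realType) (Z X : normedModType R)
    (i : {linear Z -> X}) : Prop :=
  injective i /\ forall A : set Z, bounded_set A -> precompact (i @` A).

Definition smoothing_params (R : realType) (eta kappa : R) : Prop :=
  0 <= eta < 1 /\ 0 < kappa.

Definition smoothing_i (R : realType) (X : normedModType R)
    (S : R -> X -> X) (B : set X) (T eta kappa : R)
    (Z : normedModType R) (i : {linear Z -> X}) : Prop :=
  [/\ smoothing_params eta kappa, compact_embedding i &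
    exists (C : X -> X) (M : X -> Z),
      [/\ forall x, B x -> S T x = C x + i (M x),
          forall x y, B x -> B y -> `|C x - C y| <= eta * `|x - y| &
          forall x y, B x -> B y -> `|M x - M y| <= kappa * `|x - y| ] ].

Definition smoothing_ii (R : realType) (X : normedModType R)
    (S : R -> X -> X) (B : set X) (T eta kappa : R)
    (Y : normedModType R) (j : {linear X -> Y}) : Prop :=
  [/\ smoothing_params eta kappa, compact_embedding j &
    exists C M : X -> X,
      [/\ forall x, B x -> S T x = C x + M x,
          forall x y, B x -> B y -> `|C x - C y| <= eta * `|x - y| &
          forall x y, B x -> B y -> `|M x - M y| <= kappa * `|j (x - y)| ] ].

Definition smoothing (R : realType) (X : normedModType R)
    (S : R -> X -> X) (B : set X) (T eta kappa : R) : Prop :=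
  (exists (Z : normedModType R) (i : {linear Z -> X}),
      smoothing_i S B T eta kappa i) \/
  (exists (Y : normedModType R) (j : {linear X -> Y}),
      smoothing_ii S B T eta kappa j).

Definition generalized_smoothing (R : realType) (X : normedModType R)
    (S : R -> X -> X) (B : set X) (T : R) : Prop :=
  exists (Y Z : normedModType R) (i : {linear Z -> Y}) (M : X -> Z)
      (eta mu kappa : R),
    [/\ compact_embedding i, 0 <= eta < 1, 0 < mu, 0 < kappa &
      forall x y, B x -> B y ->
        `|M x - M y| <= kappa * `|x - y| /\
        `|S T x - S T y| <= eta * `|x - y| + mu * `|i (M x - M y)| ].

Definition seminorm (R : realType) (W : normedModType R) (p : W -> R) : Prop :=
  [/\ forall w, 0 <= p w,
      forall v w, p (v + w) <= p v + p w &
      forall (a : R) w, p (a *: w) = `|a| * p w ].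

Definition compact_seminorm (R : realType) (W : normedModType R)
    (p : W -> R) : Prop :=
  seminorm p /\
  forall w : nat -> W, bounded_fun w ->
    exists2 f : nat -> nat, increasing_seq f &
      p (w (f jl.1) - w (f jl.2)) @[jl --> (\oo, \oo)] --> (0 : R).

Definition quasi_stable (R : realType) (X : normedModType R)
    (S : R -> X -> X) (B : set X) (T eta kappa : R) : Prop :=
  smoothing_params eta kappa /\
  exists (W : normedModType R) (p : W -> R) (K : X -> W),
    compact_seminorm p /\
    forall x y, B x -> B y ->
      `|K x - K y| <= kappa * `|x - y| /\
      `|S T x - S T y| <= eta * `|x - y| + p (K x - K y).

Definition separated_set (R : realType) (Y : normedModType R)
    (e : R) (U : set Y) : Prop :=
  forall x y, U x -> U y -> x <> y -> e <= `|x - y|.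

(* "m is the maximal cardinality of an e-separated subset of F"; in
   particular F has no infinite e-separated subset. *)
Definition max_separated (R : realType) (Y : normedModType R)
    (F : set Y) (e : R) (m : nat) : Prop :=
  (exists U : set Y, [/\ U `<=` F, separated_set e U & (U #= `I_m)%card]) /\
  (forall U : set Y, U `<=` F -> separated_set e U -> (U #<= `I_m)%card).

Definition centered_cover (R : realType) (X : normedModType R)
    (V G : set X) (e : R) (n : nat) : Prop :=
  exists U : set X,
    [/\ U `<=` G, (U #= `I_n)%card & G `<=` \bigcup_(x in U) (V `&` ball x e)].

(* "n = N^V(G, e)" *)
Definition covering_number (R : realType) (X : normedModType R)
    (V G : set X) (e : R) (n : nat) : Prop :=
  centered_cover V G e n /\ forall m, centered_cover V G e m -> (n <= m)%N.

Definition covering_condition (R : realType) (X : normedModType R)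
    (V : set X) (S : R -> X -> X) (B : set X) (T q : R) (h : nat) : Prop :=
  exists (k0 : nat) (a b : R),
    [/\ (0 < k0)%N, 0 < a, 0 < b &
      forall k : nat, (k0 <= k)%N ->
        exists2 N : nat,
          covering_number V (S (k%:R * T) @` B) (a * q ^+ k) N &
          N%:R <= b * h%:R ^+ k].

(* Main.v *)
(* Both alternatives of the smoothing property give an estimate
   |S T x - S T y| <= eta |x - y| + mu |i (M x - M y)| with i a compact embedding
   and M Lipschitz with constant kappa': (mu, kappa') = (1, kappa) in case (i) and
   (mu, kappa') = (kappa, 1), M = id in case (ii).  This is the generalized
   smoothing property, and K = mu M together with the compact seminorm |i .|
   gives quasi-stability with the constant mu kappa' = kappa.
   For the covering condition, cover S(kT)B by h^k sets of diameter at most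
   const * (eta + sigma)^k.  If A is one of these sets, of diameter d, then
   i (M A) lies in a translate of kappa' d times the image of the unit ball, so a
   maximal (sigma d / (2 mu))-separated subset of it has at most h points; the
   fibres of the resulting nearest-point map split A into h parts whose images
   under S T have diameter at most (eta + sigma) d.  Only at the end does one
   pick a centre in each set, which avoids the factor 2 that recentring balls at
   every step would cost. *)

Require Import Defs.
From HB Require Import structures.
From mathcomp Require Import all_boot all_order all_algebra.
From mathcomp Require Import all_classical all_reals all_analysis.
From mathcomp Require Import ring.

Set Implicit Arguments.
Unset Strict Implicit.
Unset Printing Implicit Defensive.

Import Order.TTheory GRing.Theory Num.Theory.
Import numFieldNormedType.Exports.

Local Open Scope classical_set_scope.
Local Open Scope ring_scope.

(** * Colourings with pieces of small diameter, and separated sets *)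

(* The pieces covering G are the fibres of the colouring c, so they may be
   empty. *)
Definition diam_cover (R : realType) (Y : normedModType R) (G : set Y) (d : R)
    (n : nat) : Prop :=
  exists c : Y -> nat, (forall x, G x -> (c x < n)%N) /\
    (forall x y, G x -> G y -> c x = c y -> `|x - y| <= d).

Lemma precompact_diam_cover (R : realType) (Y : normedModType R) (F : set Y)
    (d : R) : precompact F -> 0 < d -> exists n, diam_cover F d n.
Proof.
rewrite precompactE compact_cover => cF d0.
have e0 : 0 < d / 2 by rewrite divr_gt0.
have [y _|y _|D _ FD] := cF Y setT (fun y => ball y (d / 2)).
- exact: ball_open.
- by exists y => //; exact: ballxx.
pose near (y u : Y) := `[< ball u (d / 2) y >].
pose s := finmap.enum_fset D.
have has_near x : F x -> has (near x) s.
  move=> /subset_closure/FD[u uD xu]; apply/hasP.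
  by exists u => //; exact/asboolP.
(* Each point is coloured by the first ball of the finite subcover that contains it. *)
exists (size s), (fun y => find (near y) s); split => [x /has_near|].
  by rewrite has_find.
have nearE x : F x -> near x (nth 0 s (find (near x) s)).
  by move=> Fx; exact/nth_find/has_near.
move=> x y /nearE/asboolP xu /nearE/asboolP yu exy.
move: xu yu; rewrite exy -ball_normE /= => xu yu.
rewrite (splitr d) -(subrKA (nth 0 s (find (near y) s))).
by rewrite (le_trans (ler_normD _ _))// lerD// ltW// distrC.
Qed.

(** The colouring is injective on [U]: two points of [U] with one colour are at distance at most
    [d < e]. *)
Lemma separated_card_le (R : realType) (Y : normedModType R) (F U : set Y)
    (d e : R) (n : nat) :
  diam_cover F d n -> d < e -> U `<=` F -> separated_set e U ->
  (U #<= `I_n)%card.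
Proof.
move=> [c [cn cd]] de UF sepU; apply/pcard_leP/injfunPex.
exists c => [x /UF/cn//|x y /set_mem Ux /set_mem Uy cxy].
apply: contrapT => /(sepU _ _ Ux Uy); apply/negP; rewrite -ltNge.
exact: le_lt_trans (cd _ _ (UF _ Ux) (UF _ Uy) cxy) de.
Qed.

Lemma max_separated_exists (R : realType) (Y : normedModType R) (F : set Y)
    (e : R) (n : nat) :
  (forall U, U `<=` F -> separated_set e U -> (U #<= `I_n)%card) ->
  exists2 m, (m <= n)%N & max_separated F e m.
Proof.
move=> Fn.
pose P m :=
  `[< exists U : set Y, [/\ U `<=` F, separated_set e U & (U #= `I_m)%card] >].
have exP : exists m, P m.
  exists 0; apply/asboolP; exists set0; split => //.
  by rewrite II0 card_eq00.
have ubP m : P m -> (m <= n)%N.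
  move=> /asboolP[U [UF sepU Um]]; rewrite -card_le_II.
  by rewrite -(card_le_eql Um); exact: Fn.
case: (ex_maxnP exP ubP) => m Pm maxm.
exists m; first exact: ubP.
split; first exact/asboolP.
move=> U UF sepU.
have /finite_setP[k Uk] : finite_set U.
  by apply/finite_set_leP; exists n; exact: Fn.
rewrite (card_le_eql Uk) card_le_II; apply: maxm.
by apply/asboolP; exists U.
Qed.

(* A maximal separated set is a net, and a ball of radius e has diameter at
   most 2 * e. *)
Lemma max_separated_diam_cover (R : realType) (Y : normedModType R)
    (F : set Y) (e : R) (m : nat) :
  0 < e -> max_separated F e m -> diam_cover F (2 * e) m.
Proof.
move=> e0 [[U [UF sepU Um]] maxm].
have net y : exists u, F y -> U u /\ `|y - u| < e.
  have [Fy|nFy] := pselect (F y); last by exists 0.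
  apply: contrapT => /forallNP noU.
  have farU u : U u -> e <= `|y - u|.
    by move=> Uu; rewrite leNgt; apply/negP => yu; exact: (noU u).
  have nUy : ~ U y.
    by move=> /farU; rewrite subrr normr0 leNgt e0.
  (* A point at distance at least [e] from all of [U] could be added to it, giving [m + 1] separated
     points. *)
  have : (y |` U #<= `I_m)%card.
    apply: maxm.
      by move=> z [->//|/UF].
    move=> a b [->|Ua] [->|Ub] // ab; first exact: farU.
      by rewrite distrC; exact: farU.
    exact: sepU.
  have /card_le_eql-> : (y |` U #= `I_m.+1)%card.
    apply/eq_cardSP; exists y; first by left.
    rewrite (_ : (y |` U) `\ y = U)//; apply/seteqP; split => z /=.
      by move=> [[->|//]].
    by move=> Uz; split; [right|move=> zy; apply: nUy; rewrite -zy].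
  by rewrite card_le_II ltnn.
have [p pP] := choice net.
have /pcard_eqP/bijPex[f [fm finj _]] := Um.
exists (f \o p); split => [y /pP[/fm//]|x y /pP[Ux xp] /pP[Uy yp] /= fxy].
have pxy : p x = p y by apply: finj => //; exact: mem_set.
rewrite -(subrKA (p y)) mulr_natl mulr2n (le_trans (ler_normD _ _))//.
by rewrite lerD// ltW// -?pxy// distrC pxy.
Qed.

(** * Transport and refinement of colourings *)

(** A point of the image under [g] receives the colour of [f] at a chosen preimage. *)
Lemma image_diam_cover (R : realType) (X : Type) (Y W : normedModType R)
    (f : X -> Y) (g : X -> W) (A : set X) (e d : R) (n : nat) :
  diam_cover (f @` A) e n ->
  (forall x y, A x -> A y -> `|f x - f y| <= e -> `|g x - g y| <= d) ->
  diam_cover (g @` A) d n.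
Proof.
move=> [c [cn ce]] fg.
have [x0|] := pselect (exists x, A x); last first.
  move=> A0; exists (fun=> 0%N).
  by split=> [z [x Ax _]|z y [x Ax _]]; exfalso; apply: A0; exists x.
have pre z : exists x, (g @` A) z -> A x /\ g x = z.
  have [[x Ax <-]|nz] := pselect ((g @` A) z); first by exists x.
  by have [x _] := x0; exists x.
have [p pP] := choice pre.
exists (c \o f \o p); split => [z /pP[Ap _]|y z /pP[Ay yE] /pP[Az zE] /= cyz].
  by apply: cn; exists (p z).
by rewrite -yE -zE; apply: fg => //; apply: ce => //; apply: imageP.
Qed.

Lemma diam_cover_refine (R : realType) (X : normedModType R) (g : X -> X)
    (G : set X) (d d' : R) (n h : nat) :
  diam_cover G d n ->
  (forall A, A `<=` G -> (forall x y, A x -> A y -> `|x - y| <= d) ->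
    diam_cover (g @` A) d' h) ->
  diam_cover (g @` G) d' (n * h).
Proof.
move=> [c [cn cd]] refine.
have /choice[l lP] i := refine [set x | G x /\ c x = i]
  (fun x => @proj1 _ _)
  (fun x y Ax Ay => cd x y Ax.1 Ay.1 (etrans Ax.2 (esym Ay.2))).
have pre z : exists x, (g @` G) z -> G x /\ g x = z.
  have [[x Gx <-]|nz] := pselect ((g @` G) z); first by exists x.
  by exists 0.
have [p pP] := choice pre.
have lt_lh z : (g @` G) z -> (l (c (p z)) z < h)%N.
  by move=> /pP[Gp pz]; apply: (lP _).1; exists (p z).
(* The colour of the preimage and the colour inside its piece are written as one number in base [h];
   division by [h] recovers the first. *)
exists (fun z => c (p z) * h + l (c (p z)) z)%N; split => [z Gz|y z Gy Gz lyz].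
  have [Gp _] := pP _ Gz.
  have := cn _ Gp; rewrite -(@leq_pmul2r h) ?(leq_ltn_trans _ (lt_lh _ Gz))//.
  by apply: leq_trans; rewrite mulSn addnC ltn_add2r lt_lh.
have h0 : (0 < h)%N by rewrite (leq_ltn_trans _ (lt_lh _ Gz)).
have cyz : c (p y) = c (p z).
  have := congr1 (divn^~ h) lyz.
  by rewrite !divnMDl// !divn_small ?lt_lh// !addn0.
have {}lyz : l (c (p y)) y = l (c (p y)) z.
  by move: lyz; rewrite cyz => /addnI.
have [Gpy pyE] := pP _ Gy; have [Gpz pzE] := pP _ Gz.
by apply: (lP (c (p y))).2 => //; [exists (p y)|exists (p z)].
Qed.

(** One point chosen in each nonempty piece serves as a centre; the inequality [d < r] is strict
    because the covering balls are open. *)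
Lemma diam_cover_covering_number (R : realType) (X : normedModType R)
    (V G : set X) (d r : R) (n : nat) :
  diam_cover G d n -> d < r -> G `<=` V ->
  exists2 m, (m <= n)%N & covering_number V G r m.
Proof.
move=> [c [cn cd]] dr GV.
pose D := c @` G.
have rep i : exists x, D i -> G x /\ c x = i.
  have [[x Gx <-]|nD] := pselect (D i); first by exists x.
  by exists 0.
have [p pP] := choice rep.
have pDn : (p @` D #<= `I_n)%card.
  apply: (card_le_trans (card_image_le _ _)); apply: subset_card_le.
  by move=> _ [x Gx <-]; exact: cn.
have /finite_setP[k pDk] : finite_set (p @` D).
  by apply/finite_set_leP; exists n.
have kn : (k <= n)%N by rewrite -card_le_II -(card_le_eql pDk).
have covk : centered_cover V G r k.
  exists (p @` D); split => //; first by move=> _ [i /pP[Gp _] <-].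
  move=> x Gx; have Dcx : D (c x) by exists x.
  have [Gp cp] := pP _ Dcx.
  exists (p (c x)); first by exists (c x).
  split; first exact: GV.
  by rewrite -ball_normE /=; apply: le_lt_trans dr; exact: cd.
pose P m := `[< centered_cover V G r m >].
have exP : exists m, P m by exists k; exact/asboolP.
case: (ex_minnP exP) => m /asboolP covm minm.
exists m; first by rewrite (leq_trans _ kn)// minm//; exact/asboolP.
by split => // m' covm'; apply: minm; exact/asboolP.
Qed.

(** * Consequences of compactness *)

(** Every ball around a cluster point [y] of [u] is visited at arbitrarily late indices, so the
    subsequence can be chosen recursively. *)
Lemma precompact_subseq (R : realType) (Y : normedModType R) (u : nat -> Y) :
  precompact (range u) ->
  exists2 f : nat -> nat, increasing_seq f &
    exists y, forall k, `|y - u (f k)| < k.+1%:R^-1.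
Proof.
rewrite precompactE => /(_ (u @ \oo) _)[|y [_ cly]].
  by exists 0%N => // n _; apply: subset_closure; exists n.
(* The pair holds the last index chosen and the position whose rate is to be met. *)
have next (nk : nat * nat) :
    exists m, (nk.1 < m)%N /\ `|y - u m| < nk.2.+1%:R^-1.
  have e0 : 0 < nk.2.+1%:R^-1 :> R by rewrite invr_gt0.
  have tail : (u @ \oo) (u @` [set m | (nk.1 < m)%N]).
    by exists nk.1.+1 => // m /= nm; exists m.
  have [_ [[m nm <-] ym]] := cly _ _ tail (nbhsx_ballx y _ e0).
  by exists m; split=> //; move: ym; rewrite -ball_normE.
have [g gP] := choice next.
pose f := fix f k := if k is k'.+1 then g (f k', k) else g (0, 0).
exists f; first by apply/increasing_seqP => k; exact: (gP (f k, k.+1)).1.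
by exists y => -[|k]; [exact: (gP (0, 0)).2|exact: (gP (f k, k.+1)).2].
Qed.

(** The images of a bounded sequence have a subsequence converging in [Y], which is Cauchy there. *)
Lemma compact_seminorm_embedding (R : realType) (Z Y : normedModType R)
    (i : {linear Z -> Y}) :
  compact_embedding i -> compact_seminorm (fun z => `|i z|).
Proof.
move=> [_ ci]; split.
  by split=> [w|v w|a w]; rewrite ?linearD ?ler_normD// linearZ normrZ.
move=> w bw.
have bndw : bounded_set (range w).
  by move: bw; rewrite /= /bounded_near; apply: filterS => M wM _ [n _ <-]; exact: wM.
have /precompact_subseq[f incf [y yf]] : precompact (range (i \o w)).
  by rewrite -(image_comp w i); exact: ci.
exists f => //; apply/cvgr0Pnorm_lt => e e0.
have [N _ Ne] := near_infty_natSinv_lt (PosNum (divr_gt0 e0 (ltr0n R 2))).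
exists ([set n | (N <= n)%N], [set n | (N <= n)%N]).
  by split; exists N.
move=> [j l] /= [/Ne /= je /Ne /= le].
rewrite normr_id linearB -(subrKA y) (splitr e).
rewrite (le_lt_trans (ler_normD _ _))// ltrD//.
  by rewrite distrC (lt_trans (yf j)).
by rewrite (lt_trans (yf l)).
Qed.

Lemma compact_embedding_max_separated (R : realType) (Z Y : normedModType R)
    (i : {linear Z -> Y}) (e : R) :
  compact_embedding i -> 0 < e ->
  exists h, max_separated (i @` closed_ball_ Num.norm 0 1) e h.
Proof.
move=> [_ ci] e0.
have bnd1 : bounded_set (closed_ball_ Num.norm 0 1 : set Z).
  exists 1; split=> // r r1 z; rewrite /closed_ball_ /= sub0r normrN => z1.
  exact: le_trans z1 (ltW r1).
(* A piece of diameter [e / 2] holds at most one point of an [e]-separated set. *)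
have e20 : 0 < e / 2 by rewrite divr_gt0.
have [n dn] := precompact_diam_cover (ci _ bnd1) e20.
have [|h _ hP] := @max_separated_exists _ _
  (i @` closed_ball_ Num.norm 0 1) e n; last by exists h.
by move=> U; apply: (separated_card_le dn); rewrite ltr_pdivrMr// ltr_pMr// ltr1n.
Qed.

(** * The covering condition from the common estimate *)

Lemma diam_cover_smoothing (R : realType) (X Y Z : normedModType R)
    (i : {linear Z -> Y}) (M : X -> Z) (g : X -> X) (B G : set X)
    (eta mu kappa sigma d : R) (n h : nat) :
  0 <= eta -> 0 < mu -> 0 < kappa -> 0 < sigma -> 0 < d ->
  (forall x y, B x -> B y ->
     `|M x - M y| <= kappa * `|x - y| /\
     `|g x - g y| <= eta * `|x - y| + mu * `|i (M x - M y)|) ->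
  max_separated (i @` closed_ball_ Num.norm 0 1)
    (sigma / (2 * (mu * kappa))) h ->
  G `<=` B -> diam_cover G d n ->
  diam_cover (g @` G) ((eta + sigma) * d) (n * h).
Proof.
move=> eta0 mu0 k0 s0 d0 BP [_ maxh] GB dG.
set e := sigma / _ in maxh.
have e0 : 0 < e by rewrite divr_gt0// !mulr_gt0.
apply: (diam_cover_refine dG) => A AG dA.
have kd0 : 0 < kappa * d by rewrite mulr_gt0.
have [[x0 Ax0]|A0] := pselect (exists x, A x); last first.
  by exists (fun=> 0%N); split=> [z [x Ax _]|z y [x Ax _]]; exfalso;
    apply: A0; exists x.
(* Recentred at [x0] and divided by [kappa * d], the image of [A] falls into that of the unit ball,
   so the bound [h] serves for every [d]. *)
pose f x := (kappa * d)^-1 *: i (M x - M x0).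
have fB x y : A x -> A y -> f x - f y = (kappa * d)^-1 *: i (M x - M y).
  move=> Ax Ay; rewrite /f -scalerBr -linearB.
  by rewrite opprB addrA subrK.
have AB x : A x -> B x by move=> /AG/GB.
have fball : f @` A `<=` i @` closed_ball_ Num.norm 0 1.
  move=> _ [x Ax <-]; exists ((kappa * d)^-1 *: (M x - M x0)); last first.
    by rewrite linearZ.
  rewrite /closed_ball_ /= sub0r normrN normrZ gtr0_norm ?invr_gt0//.
  rewrite ler_pdivrMl// mulr1.
  rewrite (le_trans (BP _ _ (AB _ Ax) (AB _ Ax0)).1)//.
  by rewrite ler_pM2l//; exact: dA.
have [U /subset_trans-/(_ _ fball)|m mh sepm] :=
  @max_separated_exists _ _ (f @` A) e h; first exact: maxh.
have [c [cm cd]] : diam_cover (g @` A) ((eta + sigma) * d) m.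
  apply: (image_diam_cover (max_separated_diam_cover e0 sepm)) => x y Ax Ay.
  rewrite (fB _ _ Ax Ay) normrZ gtr0_norm ?invr_gt0//.
  rewrite ler_pdivrMl// => ixy.
  rewrite (le_trans (BP _ _ (AB _ Ax) (AB _ Ay)).2)// mulrDl lerD//.
    by rewrite ler_wpM2l//; exact: dA.
  (* This identity dictates [e]: a piece of diameter [2 * e], scaled back and weighted by [mu],
     contributes exactly [sigma * d]. *)
  have -> : sigma * d = mu * (kappa * d * (2 * e)).
    by rewrite /e; field; rewrite !gt_eqF.
  by rewrite ler_pM2l.
by exists c; split => // z /cm/leq_trans; apply.
Qed.

Lemma covering_condition_smoothing (R : realType) (tk : time_kind)
    (X Y Z : normedModType R) (V : set X) (S : R -> X -> X) (T : R)
    (B : set X) (i : {linear Z -> Y}) (M : X -> Z)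
    (eta mu kappa sigma : R) (h : nat) :
  semigroup_on tk V S -> time_set tk T -> B `<=` V -> bounded_set B ->
  S T @` B `<=` B ->
  0 <= eta -> 0 < mu -> 0 < kappa -> 0 < sigma ->
  (forall x y, B x -> B y ->
     `|M x - M y| <= kappa * `|x - y| /\
     `|S T x - S T y| <= eta * `|x - y| + mu * `|i (M x - M y)|) ->
  max_separated (i @` closed_ball_ Num.norm 0 1)
    (sigma / (2 * (mu * kappa))) h ->
  covering_condition V S B T (eta + sigma) h.
Proof.
move=> sgS tT BV bndB STB eta0 mu0 k0 s0 BP maxh.
have q0 : 0 < eta + sigma by rewrite ltr_wpDl.
have timeM k : time_set tk (k%:R * T).
  case: tk {sgS} tT => /=; first by move=> T0; rewrite mulr_ge0.
  by move=> [n _ <-]; exists (k * n)%N => //; rewrite natrM.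
have stepS k : S (k.+1%:R * T) @` B = S T @` (S (k%:R * T) @` B).
  rewrite image_comp; apply: eq_imagel => x Bx /=.
  rewrite (semigroup_comp sgS) //; last exact: BV.
  by rewrite -natr1 mulrDl mul1r addrC.
have S0 : S (0%:R * T) @` B = B.
  rewrite mul0r -[RHS]image_id; apply: eq_imagel => x /BV.
  exact: (semigroup_id sgS).
have SB k : S (k%:R * T) @` B `<=` B.
  elim: k => [|k IH]; first by rewrite S0.
  by rewrite stepS; apply: subset_trans STB; exact: image_subset.
have [d d0 Bd] : exists2 d, 0 < d & forall x, B x -> `|x| <= d.
  exact: pinfty_ex_gt0 bndB.
have cov k : diam_cover (S (k%:R * T) @` B)
    ((eta + sigma) ^+ k * (2 * d)) (h ^ k).
  elim: k => [|k IH].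
    rewrite S0 expr0 mul1r expn0; exists (fun=> 0%N); split=> // x y Bx By _.
    by rewrite mulr_natl mulr2n (le_trans (ler_normB _ _))// lerD// Bd.
  rewrite stepS exprS -mulrA expnSr.
  apply: (diam_cover_smoothing eta0 mu0 k0 s0 _ BP maxh _ IH) => //.
  by rewrite !mulr_gt0// exprn_gt0.
(* The summand 1 makes the radius strictly larger than the diameter of the pieces. *)
exists 1%N, (2 * d + 1), 1; split=> // [|k _].
  by rewrite addr_gt0// mulr_gt0.
have [| |m mh covm] := @diam_cover_covering_number _ _ V _ _
  ((2 * d + 1) * (eta + sigma) ^+ k) _ (cov k).
- by rewrite mulrC ltr_pM2r ?exprn_gt0// ltrDl.
- by apply: subset_trans BV; exact: SB.
by exists m => //; rewrite mul1r -natrX ler_nat.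
Qed.

(** * Quasi-stability and the two alternatives *)

Lemma quasi_stable_smoothing (R : realType) (X Y Z : normedModType R)
    (S : R -> X -> X) (B : set X) (T eta mu kappa : R)
    (i : {linear Z -> Y}) (M : X -> Z) :
  compact_embedding i -> 0 <= eta < 1 -> 0 < mu -> 0 < kappa ->
  (forall x y, B x -> B y ->
     `|M x - M y| <= kappa * `|x - y| /\
     `|S T x - S T y| <= eta * `|x - y| + mu * `|i (M x - M y)|) ->
  quasi_stable S B T eta (mu * kappa).
Proof.
move=> ci eta01 mu0 k0 BP; split; first by split=> //; exact: mulr_gt0.
exists Z, (fun z => `|i z|), (fun x => mu *: M x).
split; first exact: compact_seminorm_embedding.
move=> x y Bx By; have [Mxy Sxy] := BP x y Bx By.
rewrite -scalerBr linearZ !normrZ (gtr0_norm mu0); split=> //.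
by rewrite -mulrA ler_pM2l.
Qed.

Lemma smoothing_i_estimate (R : realType) (X Z : normedModType R)
    (S : R -> X -> X) (B : set X) (T eta kappa : R) (i : {linear Z -> X}) :
  smoothing_i S B T eta kappa i ->
  exists M : X -> Z, forall x y, B x -> B y ->
    `|M x - M y| <= kappa * `|x - y| /\
    `|S T x - S T y| <= eta * `|x - y| + 1 * `|i (M x - M y)|.
Proof.
move=> [_ _ [C [M [SE Ceta Mk]]]]; exists M => x y Bx By.
split; first exact: Mk.
rewrite !SE// opprD addrACA -linearB mul1r (le_trans (ler_normD _ _))//.
by rewrite lerD// Ceta.
Qed.

Lemma smoothing_ii_estimate (R : realType) (X Y : normedModType R)
    (S : R -> X -> X) (B : set X) (T eta kappa : R) (j : {linear X -> Y}) :
  smoothing_ii S B T eta kappa j ->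
  forall x y, B x -> B y ->
    `|x - y| <= 1 * `|x - y| /\
    `|S T x - S T y| <= eta * `|x - y| + kappa * `|j (x - y)|.
Proof.
move=> [_ _ [C [M [SE Ceta Mk]]]] x y Bx By.
split; first by rewrite mul1r.
rewrite !SE// opprD addrACA (le_trans (ler_normD _ _))//.
by rewrite lerD// ?Ceta ?Mk.
Qed.

Theorem proposition5p2 (R : realType) (tk : time_kind) (X : normedModType R)
    (V : set X) (S : R -> X -> X) (T : R) (B : set X) (eta kappa : R)
    (V_neq0 : V !=set0) (semigroupS : semigroup_on tk V S)
    (T_time : time_set tk T) (T_gt0 : 0 < T)
    (BV : B `<=` V) (bndB : bounded_set B)
    (smoothS : smoothing S B T eta kappa) :
  generalized_smoothing S B T /\
  quasi_stable S B T eta kappa /\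
  (S T @` B `<=` B ->
   forall sigma : R, 0 < sigma < 1 - eta ->
     (forall (Z : normedModType R) (i : {linear Z -> X}),
        smoothing_i S B T eta kappa i ->
        exists2 h : nat,
          max_separated (i @` closed_ball_ Num.norm 0 1)
            (sigma / (2 * kappa)) h &
          covering_condition V S B T (eta + sigma) h) /\
     (forall (Y : normedModType R) (j : {linear X -> Y}),
        smoothing_ii S B T eta kappa j ->
        exists2 h : nat,
          max_separated (j @` closed_ball_ Num.norm 0 1)
            (sigma / (2 * kappa)) h &
          covering_condition V S B T (eta + sigma) h)).
Proof.
split; [|split; [|move=> STB sigma /andP[s0 _]; split]].
- case: smoothS => [[Z [i si]]|[Y [j sj]]].
    have [[eta01 k0] ci _] := si; have [M MP] := smoothing_i_estimate si.
    by exists X, Z, i, M, eta, 1, kappa; split.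
  have [[eta01 k0] cj _] := sj.
  exists Y, X, j, id, eta, kappa, 1; split => //.
  exact: smoothing_ii_estimate sj.
- case: smoothS => [[Z [i si]]|[Y [j sj]]].
    have [[eta01 k0] ci _] := si; have [M MP] := smoothing_i_estimate si.
    by rewrite -(mul1r kappa); apply: (quasi_stable_smoothing ci eta01 _ k0 MP).
  have [[eta01 k0] cj _] := sj; rewrite -(mulr1 kappa).
  apply: (quasi_stable_smoothing (M := id) cj eta01 k0 ltr01).
  exact: smoothing_ii_estimate sj.
- move=> Z i si; have [[/andP[eta0 _] k0] ci _] := si.
  have [M MP] := smoothing_i_estimate si.
  have [|h maxh] := @compact_embedding_max_separated _ _ _ _
    (sigma / (2 * kappa)) ci; first by rewrite divr_gt0// mulr_gt0.
  exists h => //.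
  apply: (covering_condition_smoothing semigroupS _ _ _ _ eta0 ltr01 k0 s0 MP)
    => //.
  by rewrite mul1r.
- move=> Y j sj; have [[/andP[eta0 _] k0] cj _] := sj.
  have [|h maxh] := @compact_embedding_max_separated _ _ _ _
    (sigma / (2 * kappa)) cj; first by rewrite divr_gt0// mulr_gt0.
  exists h => //.
  (* The weight is now [kappa] and the Lipschitz constant 1; their product, which fixes the
     separation scale, is again [kappa]. *)
  apply: (covering_condition_smoothing (M := id) semigroupS _ _ _ _ eta0 k0
    ltr01 s0 (smoothing_ii_estimate sj)) => //.
  by rewrite mulr1.
Qed.
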